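(* Let $\boldsymbol\theta\in\mathbb R^p$ and suppose that the prior of each coordinate of $\boldsymbol\theta$ is supported on $[-1,1]$. Let $\langle\cdot\rangle$ denote the average with respect to the Gibbs (posterior) measure, and let $$\lambda_{\rm m}:=\lambda_{\max}(\nabla m_t)=\lambda_{\max}\big(\langle\boldsymbol\theta\boldsymbol\theta^\top\rangle-\langle\boldsymbol\theta\rangle\langle\boldsymbol\theta\rangle^\top\big).$$ Then $$\frac p2\big\langle|R_{1,2}-q_p|^2\big\rangle\le\lambda_{\rm m}\le p\sqrt{\big\langle|R_{1,2}-q_p|^2\big\rangle}.$$
   Context: The Gibbs measure is the posterior law of $\boldsymbol\theta\in\mathbb R^p$ with product prior $P_0^{\otimes p}$ given the linear observation $\boldsymbol y$ and the stochastic localization observation $\boldsymbol z$ at time $t$, i.e. the probability measure proportional to $\exp(-\frac{\alpha}{2\Delta}\|\boldsymbol\phi\boldsymbol\theta-\boldsymbol y\|_2^2-\frac1{2t}\|\boldsymbol z-t\boldsymbol\theta\|_2^2)P_0^{\otimes p}(d\boldsymbol\theta)$. $m_t(\boldsymbol z)=\langle\boldsymbol\theta\rangle$ is its mean as a function of $\boldsymbol z$, and $\nabla m_t$ is the Jacobian in $\boldsymbol z$, equal to the covariance matrix of the Gibbs measure. The overlap is $R_{1,2}=\frac1p\boldsymbol\theta^{1\top}\boldsymbol\theta^2$, where $\boldsymbol\theta^1,\boldsymbol\theta^2$ are two independent samples from the Gibbs measure, and $q_p=\langle R_{1,2}\rangle$ ($\langle\cdot\rangle$ also denotes the average over the two independent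 samples). $\lambda_{\max}$ is the largest eigenvalue. *)

(* Defs.v *)
From HB Require Import structures.
From mathcomp Require Import all_boot all_order all_algebra.
From mathcomp Require Import all_classical all_reals all_analysis.
From mathcomp Require Import measurable_realfun.

Set Implicit Arguments.
Unset Strict Implicit.
Unset Printing Implicit Defensive.

Import Order.TTheory GRing.Theory Num.Theory.
Import numFieldNormedType.Exports.

Local Open Scope classical_set_scope.
Local Open Scope ring_scope.

(* The real vector space R^p carries its product sigma-algebra through the type
   p.-tuple R; [vec] reads a tuple as a column vector. *)
Definition vec (R : realType) (p : nat) (theta : p.-tuple R) : 'cV[R]_p :=
  \col_i tnth theta i.

Definition sqnorm (R : realType) (n : nat) (v : 'cV[R]_n) : R :=
  \sum_i v i 0 ^+ 2.

Section tilted_measure.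
Context d (T : measurableType d) (R : realType).
Variables (mu : {measure set T -> \bar R}) (h : {mfun T >-> R}).
Local Open Scope ereal_scope.

Definition tilted (A : set T) : \bar R := \int[mu]_(x in A) (expR (h x))%:E.

Let measurable_exph (D : set T) :
  measurable_fun D (fun x => (expR (h x))%:E).
Proof.
apply: measurable_funTS; apply/measurable_EFinP.
exact: measurableT_comp.
Qed.

Let tilted0 : tilted set0 = 0.
Proof. by rewrite /tilted integral_set0. Qed.

Let tilted_ge0 A : 0 <= tilted A.
Proof. by apply: integral_ge0 => x _; rewrite lee_fin expR_ge0. Qed.

Let tilted_sigma_additive : semi_sigma_additive tilted.
Proof.
move=> F mF tF mUF; rewrite /tilted ge0_integral_bigcup//.
apply: is_cvg_nneseries => k _ _.
exact: tilted_ge0.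
Qed.

HB.instance Definition _ := isMeasure.Build _ _ _ tilted
  tilted0 tilted_ge0 tilted_sigma_additive.

End tilted_measure.

Section prior.
Context (R : realType).

Definition cons_pair (n : nat) (x : R * n.-tuple R) : n.+1.-tuple R :=
  [tuple of x.1 :: x.2].

Lemma measurable_cons_pair n : measurable_fun setT (@cons_pair n).
Proof. by apply: measurable_cons. Qed.

HB.instance Definition _ n :=
  isMeasurableFun.Build _ _ _ _ (@cons_pair n) (@measurable_cons_pair n).

Fixpoint prior (P0 : probability R R) (n : nat) : probability (n.-tuple R) R :=
  match n with
  | 0 => dirac [tuple]
  | n'.+1 => distribution (P0 \x prior P0 n')%E (@cons_pair n')
  end.

End prior.

Section gibbs.
Context (R : realType) (n p : nat) (phi : 'M[R]_(n, p)) (y : 'cV[R]_n)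
  (alpha Delta t : R) (P0 : probability R R) (z : 'rV[R]_p).

Definition log_weight (theta : p.-tuple R) : R :=
  - (alpha / (2 * Delta)) * sqnorm (phi *m vec theta - y)
  - (2 * t)^-1 * sqnorm (z^T - t *: vec theta).

Lemma measurable_log_weight : measurable_fun setT log_weight.
Proof.
have mt i : measurable_fun setT (fun th : p.-tuple R => tnth th i).
  exact: measurable_tnth.
rewrite /log_weight /sqnorm; apply: measurable_funB; apply: measurable_funM => //.
- apply: measurable_sum => i; apply: measurable_funX.
  under eq_fun do rewrite !mxE.
  apply: measurable_funB => //; apply: measurable_sum => j.
  under eq_fun do rewrite !mxE.
  exact: measurable_funM.
- apply: measurable_sum => i; apply: measurable_funX.
  under eq_fun do rewrite !mxE.
  by apply: measurable_funB => //; exact: measurable_funM.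
Qed.

HB.instance Definition _ :=
  isMeasurableFun.Build _ _ _ _ log_weight measurable_log_weight.

(* The last argument of [mnormalize] is the value returned when the total mass
   is 0 or +oo; for alpha, Delta, t > 0 the mass lies in ]0, 1]. *)
Definition gibbs : probability (p.-tuple R) R :=
  mnormalize (tilted (prior P0 p) log_weight) (prior P0 p).

Definition gibbs_mx (k l : nat) (F : p.-tuple R -> 'M[R]_(k, l)) : 'M[R]_(k, l) :=
  \matrix_(i, j) \int[gibbs]_theta F theta i j.

Definition gibbs_mean : 'cV[R]_p := gibbs_mx (@vec R p).

Definition gibbs_cov : 'M[R]_p :=
  gibbs_mx (fun theta => vec theta *m (vec theta)^T)
  - gibbs_mean *m gibbs_mean^T.

Definition gibbs2 (f : p.-tuple R * p.-tuple R -> R) : R :=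
  \int[(gibbs \x gibbs)%E]_x f x.

End gibbs.

Definition overlap (R : realType) (p : nat) (x : p.-tuple R * p.-tuple R) : R :=
  p%:R^-1 * ((vec x.1)^T *m vec x.2) 0 0.

(* Row vectors, because the library's Jacobian ['J f x] is defined for maps
   between spaces of row vectors; its (i, j) entry is the derivative of the j-th
   component of f in the i-th direction. *)
Definition m_ (R : realType) (n p : nat) (phi : 'M[R]_(n, p)) (y : 'cV[R]_n)
    (alpha Delta t : R) (P0 : probability R R) (z : 'rV[R]_p) : 'rV[R]_p :=
  (gibbs_mean phi y alpha Delta t P0 z)^T.

(* The set of eigenvalues is finite, and nonempty when A is symmetric and p > 0,
   so in that case the supremum is the largest eigenvalue. *)
Definition lambda_max (R : realType) (p : nat) (A : 'M[R]_p) : R :=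
  sup [set a | eigenvalue A a].

(* Main.v *)
Require Import Defs.
From HB Require Import structures.
From mathcomp Require Import all_boot all_order all_algebra.
From mathcomp Require Import all_classical all_reals all_analysis.
From mathcomp Require Import measurable_realfun.
From mathcomp Require Import ring lra.

Set Implicit Arguments.
Unset Strict Implicit.
Unset Printing Implicit Defensive.

Import Order.TTheory GRing.Theory Num.Theory.
Import numFieldNormedType.Exports.

Local Open Scope classical_set_scope.
Local Open Scope ring_scope.

(** Let m and C be the mean and the covariance of the Gibbs measure at z, and let
V be the variance of the overlap.

The Jacobian. The z-dependent part of the log-weight is the scalar product of z
and theta, up to terms in z alone or in theta alone ([log_weight_shift]). So the
Gibbs measure at h + z is the one at z reweighted by exp (h . theta), and the
mean at h + z is the ratio of the averages at z of theta exp (h . theta) and of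
exp (h . theta) ([Rintegral_retilt]). As theta is bounded by 1 coordinatewise
almost surely, expanding the exponential to first order gives
m (h + z) = m (z) + h C + O(|h|^2) with an explicit constant
([tilted_mean_expansion]), which is Frechet differentiability with Jacobian C.

The inequalities. Two independent samples have
p^2 V = |C|_F^2 + 2 (m C m^T), where |C|_F is the Frobenius norm
([overlap_variance]). Let lam be the largest eigenvalue of C; it is the maximum
of the Rayleigh quotient ([lambda_maxP]).

- Upper bound: lam^2 <= |C|_F^2 ([sqr_eigenvalue_le]), and m C m^T >= 0, so
  lam^2 <= p^2 V.

- Lower bound: |C|_F^2 <= lam tr C ([covar_frobenius_le]) and
  m C m^T <= lam |m|^2, so p^2 V <= lam (tr C + 2 |m|^2). Since
  tr C + |m|^2 is the average of |theta|^2, it is at most p, and so is |m|^2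
  ([sum_variance_le]); hence p^2 V <= 2 p lam. *)

(** * Integration of functions that are bounded on a set of full measure *)

Section bounded_measurable.
Context d (T : measurableType d) (R : realType).
Implicit Types (K : set T) (f g : T -> R).

(** The prior lives on the cube, but its densities and coordinates are functions
on the whole of R^p, unbounded outside the cube; hence the bound on [K] only,
next to measurability everywhere. The class is an algebra stable under [expR],
so membership is syntactic for every integrand below. *)
Definition bounded_measurable K f :=
  measurable_fun setT f /\ exists M, forall x, K x -> `|f x| <= M.

Lemma bounded_measurable_cst K (c : R) : bounded_measurable K (cst c).
Proof. by split; [exact: measurable_cst | exists `|c|]. Qed.

Lemma bounded_measurableD K f g : bounded_measurable K f ->
  bounded_measurable K g -> bounded_measurable K (fun x => f x + g x).
Proof.
move=> [mf [M fM]] [mg [N gN]]; split; first exact: measurable_funD.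
by exists (M + N) => x Kx; rewrite (le_trans (ler_normD _ _))// lerD ?fM ?gN.
Qed.

Lemma bounded_measurableM K f g : bounded_measurable K f ->
  bounded_measurable K g -> bounded_measurable K (fun x => f x * g x).
Proof.
move=> [mf [M fM]] [mg [N gN]]; split; first exact: measurable_funM.
by exists (M * N) => x Kx; rewrite normrM ler_pM ?fM ?gN.
Qed.

Lemma bounded_measurableN K f : bounded_measurable K f ->
  bounded_measurable K (fun x => - f x).
Proof.
move=> [mf [M fM]]; split; first exact: measurableT_comp.
by exists M => x Kx; rewrite normrN fM.
Qed.

Lemma bounded_measurable_norm K f : bounded_measurable K f ->
  bounded_measurable K (fun x => `|f x|).
Proof.
move=> [mf [M fM]]; split; first exact: measurableT_comp.
by exists M => x Kx; rewrite normr_id fM.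
Qed.

Lemma bounded_measurableB K f g : bounded_measurable K f ->
  bounded_measurable K g -> bounded_measurable K (fun x => f x - g x).
Proof.
by move=> bf bg; apply: bounded_measurableD => //; exact: bounded_measurableN.
Qed.

Lemma bounded_measurableZ K (c : R) f : bounded_measurable K f ->
  bounded_measurable K (fun x => c * f x).
Proof.
by apply: bounded_measurableM; exact: bounded_measurable_cst.
Qed.

Lemma bounded_measurable_sum K I (s : seq I) (F : I -> T -> R) :
  (forall i, bounded_measurable K (F i)) ->
  bounded_measurable K (fun x => \sum_(i <- s) F i x).
Proof.
move=> bF; elim: s => [|i s IH].
  under eq_fun do rewrite big_nil; exact: bounded_measurable_cst.
under eq_fun do rewrite big_cons; exact: bounded_measurableD.
Qed.

Lemma bounded_measurableX K f n : bounded_measurable K f ->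
  bounded_measurable K (fun x => f x ^+ n).
Proof.
move=> bf; elim: n => [|n IH].
  under eq_fun do rewrite expr0; exact: bounded_measurable_cst.
under eq_fun do rewrite exprS; exact: bounded_measurableM.
Qed.

Lemma bounded_measurable_expR K f : bounded_measurable K f ->
  bounded_measurable K (fun x => expR (f x)).
Proof.
move=> [mf [M fM]]; split; first exact: measurableT_comp.
exists (expR M) => x Kx; rewrite ger0_norm ?expR_ge0// ler_expR.
exact: le_trans (ler_norm _) (fM _ Kx).
Qed.

End bounded_measurable.

Section full_set_integral.
Context d (T : measurableType d) (R : realType) (P : probability T R).
Variable K : set T.
Hypotheses (mK : measurable K) (PK : P K = 1%E).
Implicit Types f g : T -> R.
Local Notation E f := (\int[P]_x f x).

Let PCK0 : P (~` K) = 0%E.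
Proof. by rewrite probability_setC// PK subee. Qed.

(** The complement of [K] is negligible, and on [K] a bounded function is
integrable against a finite measure. *)
Lemma bounded_measurable_integrable (D : set T) f : measurable D ->
  bounded_measurable K f -> P.-integrable D (EFin \o f).
Proof.
move=> mD [mf [M fM]]; apply: (@integrableS _ _ _ _ setT) => //.
apply/(@negligible_integrable _ _ _ _ _ (~` K)) => //.
- exact: measurableC.
- exact/measurable_EFinP.
- rewrite setTD setCK; apply: measurable_bounded_integrable => //.
  + by have : (P K < +oo)%E by rewrite PK ltry.
  + exact: measurable_funTS.
  + exists M; split; first exact: num_real.
    by move=> N MN x Kx; rewrite /= (le_trans (fM _ Kx))// ltW.
Qed.

Let intg f : bounded_measurable K f -> P.-integrable setT (EFin \o f).
Proof. exact: bounded_measurable_integrable. Qed.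

Lemma bounded_Rintegral_restrict f : bounded_measurable K f ->
  E f = \int[P]_(x in K) f x.
Proof.
move=> bf; rewrite /Rintegral (@negligible_integral _ _ _ _ _ (~` K))//.
- by rewrite setTD setCK.
- exact: measurableC.
- exact: intg.
Qed.

Lemma probability_Rintegral_cst (c : R) : E (cst c) = c.
Proof. by rewrite Rintegral_cst// [X in fine X](probability_setT P) mulr1. Qed.

Lemma bounded_RintegralD f g : bounded_measurable K f -> bounded_measurable K g ->
  \int[P]_x (f x + g x) = E f + E g.
Proof. by move=> bf bg; rewrite RintegralD//; exact: intg. Qed.

Lemma bounded_RintegralB f g : bounded_measurable K f -> bounded_measurable K g ->
  \int[P]_x (f x - g x) = E f - E g.
Proof. by move=> bf bg; rewrite RintegralB//; exact: intg. Qed.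

Lemma bounded_RintegralZl (c : R) f : bounded_measurable K f ->
  \int[P]_x (c * f x) = c * E f.
Proof. by move=> bf; rewrite RintegralZl//; exact: intg. Qed.

Lemma bounded_Rintegral_sum I (s : seq I) (F : I -> T -> R) :
  (forall i, bounded_measurable K (F i)) ->
  \int[P]_x (\sum_(i <- s) F i x) = \sum_(i <- s) E (F i).
Proof.
move=> bF; elim: s => [|i s IH].
  rewrite big_nil; under eq_Rintegral do rewrite big_nil.
  exact: probability_Rintegral_cst.
rewrite big_cons -IH -bounded_RintegralD//; last exact: bounded_measurable_sum.
by apply: eq_Rintegral => x _; rewrite big_cons.
Qed.

Lemma le_bounded_Rintegral f g : bounded_measurable K f -> bounded_measurable K g ->
  (forall x, K x -> f x <= g x) -> E f <= E g.
Proof.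
move=> bf bg fg; rewrite !bounded_Rintegral_restrict//.
by apply: le_Rintegral => //; exact: bounded_measurable_integrable.
Qed.

Lemma bounded_Rintegral_ge c f : bounded_measurable K f ->
  (forall x, K x -> c <= f x) -> c <= E f.
Proof.
move=> bf cf; rewrite -[leLHS]probability_Rintegral_cst.
apply: le_bounded_Rintegral => //.
exact: bounded_measurable_cst.
Qed.

Lemma normr_bounded_Rintegral_le c f : bounded_measurable K f ->
  (forall x, K x -> `|f x| <= c) -> `|E f| <= c.
Proof.
move=> bf fc; rewrite ler_norml; apply/andP; split.
  by apply: bounded_Rintegral_ge => // x /fc; rewrite ler_norml => /andP[].
rewrite -[leRHS]probability_Rintegral_cst; apply: le_bounded_Rintegral => //.
  exact: bounded_measurable_cst.
by move=> x /fc; rewrite ler_norml => /andP[].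
Qed.

End full_set_integral.

(** * The largest eigenvalue of a real symmetric matrix *)

Section largest_eigenvalue.
Context (R : realType) (p : nat).
Implicit Types (u v w : 'rV[R]_p) (C : 'M[R]_p).

Definition dotv u v : R := (u *m v^T) 0 0.

Lemma dotvE u v : dotv u v = \sum_i u 0 i * v 0 i.
Proof. by rewrite /dotv mxE; apply: eq_bigr => i _; rewrite mxE. Qed.

Lemma dotvC u v : dotv u v = dotv v u.
Proof. by rewrite !dotvE; apply: eq_bigr => i _; rewrite mulrC. Qed.

Lemma dotvDl u v w : dotv (u + v) w = dotv u w + dotv v w.
Proof. by rewrite /dotv mulmxDl mxE. Qed.

Lemma dotvZl a u v : dotv (a *: u) v = a * dotv u v.
Proof. by rewrite /dotv -scalemxAl mxE. Qed.

Lemma dotvDr u v w : dotv u (v + w) = dotv u v + dotv u w.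
Proof. by rewrite dotvC dotvDl !(dotvC _ u). Qed.

Lemma dotvZr a u v : dotv u (a *: v) = a * dotv u v.
Proof. by rewrite dotvC dotvZl dotvC. Qed.

Lemma dotvv_ge0 u : 0 <= dotv u u.
Proof. by rewrite dotvE sumr_ge0// => i _; rewrite -expr2 sqr_ge0. Qed.

Lemma dotvv_eq0 u : (dotv u u == 0) = (u == 0).
Proof.
apply/idP/eqP => [|->]; last by rewrite /dotv mul0mx mxE.
rewrite dotvE psumr_eq0; last by move=> i _; rewrite -expr2 sqr_ge0.
move/allP => u0; apply/rowP => i; rewrite mxE; apply/eqP.
have /= := u0 i (mem_index_enum _).
by rewrite mulf_eq0 orbb.
Qed.

Lemma dotvv_gt0 u : (0 < dotv u u) = (u != 0).
Proof. by rewrite lt_neqAle dotvv_ge0 andbT eq_sym dotvv_eq0. Qed.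

Lemma dotv_mulmx C u v : dotv (u *m C) v = dotv u (v *m C^T).
Proof. by rewrite /dotv trmx_mul trmxK mulmxA. Qed.

Lemma quad_formE C v :
  dotv (v *m C) v = \sum_i \sum_j v 0 i * C i j * v 0 j.
Proof.
rewrite dotvE exchange_big; apply: eq_bigr => j _ /=.
by rewrite mxE big_distrl.
Qed.

Lemma continuous_quad_form C : continuous (fun v => dotv (v *m C) v).
Proof.
under eq_fun do rewrite quad_formE.
apply: continuous_big => [|i _]; first exact: add_continuous.
apply: continuous_big => [|j _]; first exact: add_continuous.
move=> v; apply: (@continuousM _ _ (fun v => v 0 i * C i j) (fun v => v 0 j)).
  apply: (@continuousM _ _ (fun v => v 0 i) (cst (C i j))).
    exact: coord_continuous.
  exact: cst_continuous.
exact: coord_continuous.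
Qed.

Lemma continuous_dotvv : continuous (fun v => dotv v v).
Proof.
by have := @continuous_quad_form 1%:M; under eq_fun do rewrite mulmx1.
Qed.

Lemma compact_sphere : compact [set v | dotv v v = 1].
Proof.
apply: bounded_closed_compact.
  exists 1; split; first exact: num_real.
  move=> M M1 v /= v1; rewrite [leLHS]/Num.norm /= mx_normrE.
  apply: (le_trans _ (ltW M1)); apply/bigmax_leP; split => // -[i j] _ /=.
  rewrite ord1 -(@ler_pXn2r _ 2)// ?nnegrE// expr1n -normrX ger0_norm ?sqr_ge0//.
  rewrite -v1 dotvE (bigD1 j)//= -expr2 lerDl sumr_ge0// => k _.
  by rewrite -expr2 sqr_ge0.
have /continuous_closedP cl := continuous_dotvv.
exact: cl _ (@closed_eq _ 1).
Qed.

(** Otherwise the quadratic form, which vanishes at [v], would take negative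
values at [v - s *: (v *m C)] for small [s > 0]. *)
Lemma psd_isotropic_kernel C v : C^T = C ->
  (forall u, 0 <= dotv (u *m C) u) -> dotv (v *m C) v = 0 -> v *m C = 0.
Proof.
move=> Csym Cge0 vCv; apply/eqP; rewrite -dotvv_eq0; apply/eqP.
set w := v *m C; set b := dotv w w; pose a := dotv (w *m C) w.
have a0 : 0 <= a by exact: Cge0.
have a1 : 0 < 1 + a by rewrite ltr_pwDl.
(* With step [s = b / (1 + a)] the form equals [- b ^ 2 (2 + a) / (1 + a) ^ 2]. *)
have := Cge0 (v + (- b / (1 + a)) *: w).
have wC : dotv (w *m C) v = b by rewrite dotv_mulmx Csym.
rewrite mulmxDl -scalemxAl dotvDl !dotvDr !dotvZl !dotvZr vCv wC -/w -/b -/a.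
have -> : 0 + - b / (1 + a) * b + (- b / (1 + a) * b +
    - b / (1 + a) * (- b / (1 + a) * a)) = - (b ^+ 2 * ((2 + a) / (1 + a) ^+ 2)).
  by field; rewrite gt_eqF.
rewrite oppr_ge0 => b0; apply/eqP; rewrite -sqrf_eq0 -[_ == _]orbF.
have c0 : 0 < (2 + a) / (1 + a) ^+ 2 by rewrite divr_gt0 ?exprn_gt0// ltr_pwDl.
by rewrite -(gt_eqF c0) -mulf_eq0 eq_le b0 mulr_ge0 ?sqr_ge0 ?ltW.
Qed.

(** The variational route to the spectral theorem: the quadratic form of [C]
attains its maximum [lam] on the compact unit sphere, at some [c]; then
[lam%:M - C] is positive semidefinite and its form vanishes at [c], so [c] lies
in its kernel. *)
Lemma exists_max_rayleigh C : (0 < p)%N -> C^T = C ->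
  exists lam, eigenvalue C lam /\
    forall v, dotv (v *m C) v <= lam * dotv v v.
Proof.
move=> p0 Csym.
have S0 : [set v | dotv v v = 1] !=set0.
  exists (delta_mx 0 (Ordinal p0)) => /=.
  rewrite dotvE (bigD1 (Ordinal p0))//= big1 ?addr0 => [|i ip].
    by rewrite mxE !eqxx mulr1.
  by rewrite mxE (negPf ip) andbF mul0r.
have [c /[!inE]/= c1 cmax] := EVT_max_rV S0 compact_sphere
  (continuous_subspaceT (@continuous_quad_form C)).
set lam := dotv (c *m C) c in cmax.
have ray v : dotv (v *m C) v <= lam * dotv v v.
  have [->|v0] := eqVneq v 0; first by rewrite /dotv !mul0mx !mxE mulr0.
  have vv0 : 0 < dotv v v by rewrite dotvv_gt0.
  set s := (Num.sqrt (dotv v v))^-1.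
  have s2 : s * s = (dotv v v)^-1 by rewrite -expr2 exprVn sqr_sqrtr// ltW.
  have := cmax (s *: v); rewrite inE /= dotvZl dotvZr mulrA s2 mulVf ?gt_eqF//.
  move=> /(_ erefl); rewrite -scalemxAl dotvZl dotvZr mulrA s2.
  by rewrite mulrC ler_pdivrMr.
exists lam; split => //; apply/eigenvalueP; exists c; last first.
  by rewrite -dotvv_gt0 c1.
have shiftE u : u *m (lam%:M - C) = lam *: u - u *m C.
  by rewrite mulmxBr mul_mx_scalar.
have dotvNl u v : dotv (- u) v = - dotv u v by rewrite -scaleN1r dotvZl mulN1r.
apply/esym/eqP; rewrite -subr_eq0 -shiftE; apply/eqP.
apply: psd_isotropic_kernel => [|u|].
- by rewrite linearB /= tr_scalar_mx Csym.
- by rewrite shiftE dotvDl dotvNl dotvZl subr_ge0.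
- by rewrite shiftE dotvDl dotvNl dotvZl c1 mulr1 subrr.
Qed.

Lemma lambda_maxP C : (0 < p)%N -> C^T = C ->
  eigenvalue C (lambda_max C) /\
  forall v, dotv (v *m C) v <= lambda_max C * dotv v v.
Proof.
move=> p0 Csym; have [lam [elam ray]] := exists_max_rayleigh p0 Csym.
suff -> : lambda_max C = lam by [].
have ub : ubound [set a | eigenvalue C a] lam.
  move=> a /= /eigenvalueP[v vC v0].
  by have := ray v; rewrite vC dotvZl ler_pM2r// dotvv_gt0.
apply/eqP; rewrite eq_le; apply/andP; split.
  by apply: ge_sup => //; exists lam.
by apply: ub_le_sup => //; exists lam.
Qed.

(** For an eigenvector [v], the bound is the nonnegativity of the squared
Frobenius distance between [a *: (v^T *m v)] and [dotv v v *: C]. *)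
Lemma sqr_eigenvalue_le C a : eigenvalue C a ->
  a ^+ 2 <= \sum_i \sum_j C i j ^+ 2.
Proof.
move=> /eigenvalueP[v vC v0]; have s0 : 0 < dotv v v by rewrite dotvv_gt0.
set s := dotv v v in s0; set F := \sum_i _.
have s2 : \sum_i \sum_j (v 0 i * v 0 j) ^+ 2 = s ^+ 2.
  rewrite /s expr2 dotvE big_distrl; apply: eq_bigr => i _ /=.
  by rewrite big_distrr; apply: eq_bigr => j _ /=; ring.
have vCv : \sum_i \sum_j v 0 i * C i j * v 0 j = a * s.
  by rewrite -quad_formE vC dotvZl.
have : 0 <= \sum_i \sum_j (a * (v 0 i * v 0 j) - s * C i j) ^+ 2.
  by do 2 (apply: sumr_ge0 => ? _); exact: sqr_ge0.
have -> : \sum_i \sum_j (a * (v 0 i * v 0 j) - s * C i j) ^+ 2 =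
    a ^+ 2 * s ^+ 2 - 2 * a * s * (a * s) + s ^+ 2 * F.
  rewrite -vCv -[in a ^+ 2 * _]s2 !mulr_sumr -sumrB -big_split /=.
  apply: eq_bigr => i _; rewrite !mulr_sumr -sumrB -big_split /=.
  by apply: eq_bigr => j _; ring.
have -> : a ^+ 2 * s ^+ 2 - 2 * a * s * (a * s) + s ^+ 2 * F =
    s ^+ 2 * (F - a ^+ 2) by ring.
by rewrite pmulr_rge0 ?exprn_gt0// subr_ge0.
Qed.

End largest_eigenvalue.

(** * Exponentially tilted probability measures *)

Section tilted_integral.
Context d (T : measurableType d) (R : realType).
Import HBNNSimple.

(** A change of density: it holds for indicators by the definition of [tilted],
hence for simple functions by linearity, and passes to the limit along
increasing simple approximations of [f] by monotone convergence. *)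
Lemma ge0_integral_tilted (mu : {measure set T -> \bar R}) (h : {mfun T >-> R})
    (f : T -> \bar R) :
  (forall x, 0 <= f x)%E -> measurable_fun setT f ->
  (\int[tilted mu h]_x f x = \int[mu]_x (f x * (expR (h x))%:E))%E.
Proof.
move=> f0 mf; pose a := nnsfun_approx measurableT mf.
have meh : measurable_fun setT (fun x => (expR (h x))%:E).
  by apply/measurable_EFinP; exact: measurableT_comp.
have ma n : measurable_fun setT (fun x => (a n x)%:E).
  by apply/measurable_EFinP; exact: measurable_funP.
have ndec x n m : (n <= m)%N -> ((a n x)%:E <= (a m x)%:E)%E.
  by move=> nm; rewrite lee_fin; exact/lefP/nd_nnsfun_approx.
transitivity (limn (fun n => \int[tilted mu h]_x (a n x)%:E))%E.
  rewrite -monotone_convergence//.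
  - by apply: eq_integral => x _; apply/esym/cvg_lim => //;
      exact: cvg_nnsfun_approx.
  - by move=> n x _; rewrite lee_fin.
  - by move=> x _ n m; exact: ndec.
transitivity (limn (fun n => \int[mu]_x ((a n x)%:E * (expR (h x))%:E)))%E;
    last first.
  rewrite -monotone_convergence//.
  - apply: eq_integral => x _; apply/cvg_lim => //; apply: cvgeZr => //.
    exact: cvg_nnsfun_approx.
  - by move=> n; exact: emeasurable_funM.
  - by move=> n x _; rewrite mule_ge0 ?lee_fin ?expR_ge0.
  - by move=> x _ n m nm; rewrite lee_wpmul2r ?lee_fin ?expR_ge0//; exact: ndec.
congr (limn _); apply/funext => n.
have mind r : measurable_fun setT (fun x => (r * \1_(a n @^-1` [set r]) x)%:E).
  by apply/measurable_EFinP; exact: measurable_funM.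
transitivity (\int[tilted mu h]_x
   (\sum_(r \in range (a n)) (r * \1_(a n @^-1` [set r]) x)%:E))%E.
  by apply: eq_integral => x _; rewrite fimfunE -fsumEFin.
transitivity (\int[mu]_x (\sum_(r \in range (a n))
    ((r * \1_(a n @^-1` [set r]) x)%:E * (expR (h x))%:E)))%E; last first.
  apply: eq_integral => x _.
  rewrite -ge0_mule_fsuml => [|r]; last exact: nnfun_muleindic_ge0.
  by rewrite fsumEFin// -(fimfunE _ x).
rewrite !ge0_integral_fsum//.
- apply: eq_fsbigr => r /[!inE] -[x _ ar].
  under eq_integral do rewrite EFinM.
  rewrite integralZl_indic_nnsfun// integral_indic// setIT.
  under [RHS]eq_integral do rewrite EFinM -muleA.
  rewrite [RHS]ge0_integralZl//.
  + under [in RHS]eq_integral do rewrite muleC.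
    rewrite [in RHS](eq_integral
      ((fun x => (expR (h x))%:E) \_ (a n @^-1` [set r]))); last first.
      by move=> y _; rewrite epatch_indic.
    by rewrite -integral_mkcond.
  + by apply: emeasurable_funM => //; exact/measurable_EFinP.
  + by rewrite -ar lee_fin.
- by move=> r; exact: emeasurable_funM.
- move=> r x _; apply: mule_ge0; last by rewrite lee_fin expR_ge0.
  by rewrite EFinM; exact: nnfun_muleindic_ge0.
- by move=> r x _; rewrite EFinM; exact: nnfun_muleindic_ge0.
Qed.

End tilted_integral.

Section gibbs_tilt.
Context d (T : measurableType d) (R : realType).
Variables (P : probability T R) (K : set T).
Hypotheses (mK : measurable K) (PK : P K = 1%E).

Section one_tilt.
Variable h : {mfun T >-> R}.
Hypothesis bh : bounded_measurable K h.

Let G : probability T R := mnormalize (tilted P h) P.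
Let Z := \int[P]_x expR (h x).

Let beh : bounded_measurable K (fun x => expR (h x)).
Proof. exact: bounded_measurable_expR. Qed.

(** The total mass of the tilted measure is bounded below because [h] is bounded
on [K]; being also finite, it excludes the default branch of [mnormalize]. *)
Lemma partition_gt0 : 0 < Z.
Proof.
have [_ [M hM]] := bh; apply: (@lt_le_trans _ _ (expR (- M))).
  exact: expR_gt0.
apply: (bounded_Rintegral_ge mK PK beh) => x Kx; rewrite ler_expR.
by have := hM _ Kx; rewrite ler_norml => /andP[].
Qed.

Lemma tilted_setT : tilted P h setT = Z%:E.
Proof.
rewrite /tilted /Z /Rintegral fineK//.
exact: (integrable_fin_num _ (bounded_measurable_integrable mK PK _ beh)).
Qed.

Lemma mnormalize_tiltedE A : G A = (tilted P h A * Z^-1%:E)%E.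
Proof.
have ZE : (tilted P h : {measure set T -> \bar R}) setT = Z%:E := tilted_setT.
rewrite -[LHS]/(mnormalize (tilted P h) P A) /mnormalize.
by rewrite ZE eqe gt_eqF ?partition_gt0.
Qed.

Lemma mnormalize_tilted_full : G K = 1%E.
Proof.
have PCK0 : P (~` K) = 0%E by rewrite probability_setC// PK subee.
have mCK : measurable (~` K) by exact: measurableC.
have GCK0 : G (~` K) = 0%E.
  rewrite mnormalize_tiltedE /tilted (null_set_integral mCK) ?mul0e//.
  by apply/measurable_EFinP/measurable_funTS; case: beh.
have := probability_setC G mCK.
by rewrite setCK [X in (_ - X)%E]GCK0 sube0.
Qed.

Let ge0_Rintegral_mnormalize (f : T -> R) : bounded_measurable K f ->
  (forall x, 0 <= f x) ->
  \int[G]_x f x = (\int[P]_x (f x * expR (h x))) / Z.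
Proof.
move=> bf f0; have mf : measurable_fun setT (EFin \o f).
  by apply/measurable_EFinP; case: bf.
have Zi : 0 <= Z^-1 by rewrite invr_ge0 ltW// partition_gt0.
rewrite /Rintegral.
rewrite (eq_measure_integral (mscale (NngNum Zi) (tilted P h))); last first.
  by move=> A mA _; apply: etrans (mnormalize_tiltedE A) _; exact: muleC.
rewrite ge0_integral_mscale//=; last by move=> x _; rewrite lee_fin.
have tE := ge0_integral_tilted P h (f := EFin \o f) _ mf.
rewrite [X in (_ * X)%E]tE => [|x]; last by rewrite lee_fin.
rewrite fineM//=; last exact: (integrable_fin_num _
  (bounded_measurable_integrable mK PK _ (bounded_measurableM bf beh))).
by rewrite mulrC.
Qed.

Lemma Rintegral_mnormalize_tilted (f : T -> R) : bounded_measurable K f ->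
  \int[G]_x f x = (\int[P]_x (f x * expR (h x))) / Z.
Proof.
move=> bf; have bn := bounded_measurable_norm bf.
(* A difference of two nonnegative functions of the same class. *)
have -> : f = (fun x => (`|f x| + f x) - `|f x|).
  by apply/funext => x; rewrite addrAC subrr add0r.
rewrite (bounded_RintegralB mK mnormalize_tilted_full)//; last first.
  exact: bounded_measurableD.
rewrite !ge0_Rintegral_mnormalize//; last 2 first.
  exact: bounded_measurableD.
  by move=> x; rewrite -lerBlDr sub0r -normrN ler_norm.
under [in RHS]eq_Rintegral do rewrite mulrBl.
rewrite (bounded_RintegralB mK PK) ?mulrBl//; apply: bounded_measurableM => //.
exact: bounded_measurableD.
Qed.

End one_tilt.

(** Tilting a Gibbs measure further by [u] amounts to reweighting it by
[expR (u x)]; the constant [c] is absorbed by the normalization. Applied to the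
log-weights at [z] and at [h + z], this expresses averages at [h + z] as ratios
of averages at [z], so that derivatives can be taken at a fixed measure. *)
Lemma Rintegral_retilt (h h' : {mfun T >-> R}) (u f : T -> R) (c : R) :
  bounded_measurable K h -> bounded_measurable K u -> bounded_measurable K f ->
  (forall x, h' x = h x + u x + c) ->
  let E f := \int[mnormalize (tilted P h) P]_x f x in
  \int[mnormalize (tilted P h') P]_x f x =
  E (fun x => f x * expR (u x)) / E (fun x => expR (u x)).
Proof.
move=> bh bu bf h'E E; rewrite /E.
have bh' : bounded_measurable K h'.
  rewrite (_ : h' = (fun x => h x + u x + c) :> (_ -> _)); last exact/funext.
  apply: (bounded_measurableD (g := cst c)); last exact: bounded_measurable_cst.
  exact: bounded_measurableD.
have beu := bounded_measurable_expR bu.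
have beh := bounded_measurable_expR bh.
have splitE g : bounded_measurable K g -> \int[P]_x (g x * expR (h' x)) =
    expR c * \int[P]_x (g x * expR (u x) * expR (h x)).
  move=> bg; rewrite -(bounded_RintegralZl mK PK); last first.
    by do 2 apply: bounded_measurableM => //.
  by apply: eq_Rintegral => x _; rewrite h'E 2!expRD; ring.
have Z0 := partition_gt0 bh; have Z'0 := partition_gt0 bh'.
rewrite (Rintegral_mnormalize_tilted bh' bf) (Rintegral_mnormalize_tilted bh beu).
rewrite (Rintegral_mnormalize_tilted bh (bounded_measurableM bf beu)).
have Z'E : \int[P]_x expR (h' x) =
    expR c * \int[P]_x (expR (u x) * expR (h x)).
  under eq_Rintegral do rewrite -[expR (h' _)]mul1r.
  rewrite (splitE (cst 1)); last exact: bounded_measurable_cst.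
  by under eq_Rintegral do rewrite mul1r.
move: Z'0; rewrite splitE// Z'E => /lt0r_neq0; rewrite mulf_eq0 negb_or.
by move=> /andP[c0 I0]; field; rewrite c0 I0 gt_eqF.
Qed.

End gibbs_tilt.

(** * The prior on the cube and the log-weight of the Gibbs measure *)

Section cube.
Context (R : realType).

Definition cube (p : nat) : set (p.-tuple R) :=
  [set th | forall i, `|tnth th i| <= 1].
Arguments cube : clear implicits.

Lemma measurable_cube p : measurable (cube p).
Proof.
rewrite (_ : cube p = \bigcap_(i in [set: 'I_p])
    ((fun th : p.-tuple R => tnth th i) @^-1` `[-1, 1]%classic)).
  apply: fin_bigcap_measurable; first exact: finite_finset.
  move=> i _; rewrite -[_ @^-1` _]setTI.
  exact: measurable_tnth.
apply/seteqP; split=> th /= thK i.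
  by move=> _; rewrite /= in_itv /= -ler_norml.
by have := thK i I; rewrite /= in_itv /= -ler_norml.
Qed.

Lemma bounded_measurable_tnth p (i : 'I_p) :
  bounded_measurable (cube p) (fun th => tnth th i).
Proof. by split; [exact: measurable_tnth | exists 1 => th; exact]. Qed.

Lemma prior_cube (P0 : probability R R) p :
  P0 `[-1, 1]%classic = 1%E -> prior P0 p (cube p) = 1%E.
Proof.
move=> P01; elim: p => [|p IH].
  by rewrite /prior /= diracE mem_set// => -[].
rewrite /prior -/prior /distribution /pushforward /=.
rewrite (_ : _ @^-1` _ = `[-1, 1]%classic `*` cube p).
  rewrite [LHS]product_measure1E//; last exact: measurable_cube.
  by rewrite [X in (X * _)%E]P01 [X in (_ * X)%E]IH mule1.
apply/seteqP; split=> -[x th] /=.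
  move=> H; split.
    by have := H ord0; rewrite tnth0 /= in_itv /= -ler_norml.
  by move=> i; have := H (lift ord0 i); rewrite tnthS.
move=> [+ thK] i; rewrite in_itv /= -ler_norml => x1.
by case: (unliftP ord0 i) => [j|] ->; rewrite ?tnthS ?tnth0.
Qed.

End cube.
Arguments cube {R} p _.

Section log_weight.
Context (R : realType) (n p : nat) (phi : 'M[R]_(n, p)) (y : 'cV[R]_n)
  (alpha Delta t : R).
Local Notation lw := (log_weight phi y alpha Delta t).

Lemma bounded_measurable_log_weight (z : 'rV[R]_p) :
  bounded_measurable (cube p) (lw z).
Proof.
have bt := @bounded_measurable_tnth R p.
rewrite /log_weight /sqnorm; apply: bounded_measurableB;
    apply: bounded_measurableZ; apply: bounded_measurable_sum => i;
    apply: bounded_measurableX; under eq_fun do rewrite !mxE.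
- apply: bounded_measurableB; last exact: bounded_measurable_cst.
  apply: bounded_measurable_sum => j; under eq_fun do rewrite !mxE.
  exact: bounded_measurableZ.
- apply: bounded_measurableB; first exact: bounded_measurable_cst.
  exact: bounded_measurableZ.
Qed.

(** The term in [phi] does not depend on [z], and the square of [z - t theta] is
expanded: [h] and [theta] are coupled only through their scalar product, the
factor [t] cancelling. *)
Lemma log_weight_shift (z h : 'rV[R]_p) (th : p.-tuple R) : t != 0 ->
  lw (h + z) th = lw z th + \sum_i h 0 i * tnth th i
    - (2 * t)^-1 * \sum_i (h 0 i ^+ 2 + 2 * (h 0 i * z 0 i)).
Proof.
move=> t0; rewrite /log_weight -!addrA; congr (_ + _).
rewrite -!mulNr /sqnorm !mulr_sumr -!big_split /=.
by apply: eq_bigr => i _; rewrite !mxE; field.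
Qed.

End log_weight.

(** * Jacobians from quadratic remainder bounds *)

Section jacobian_criterion.
Context (R : realType).

Lemma normr_rowP n (v : 'rV[R]_n) (c : R) :
  0 <= c -> (forall i, `|v 0 i| <= c) -> `|v| <= c.
Proof.
move=> c0 vc; rewrite [leLHS]/Num.norm /= mx_normrE.
by apply/bigmax_leP; split => // -[i j] _ /=; rewrite ord1.
Qed.

Lemma ler_norm_coord n (v : 'rV[R]_n) i : `|v 0 i| <= `|v|.
Proof.
rewrite [leRHS]/Num.norm /= mx_normrE.
exact: (le_bigmax _ (fun ij : 'I_1 * 'I_n => `|v ij.1 ij.2|) (0, i)).
Qed.

Lemma mulmx_continuous m n (A : 'M[R]_(m, n)) :
  continuous (fun h : 'rV[R]_m => h *m A).
Proof.
apply: (@bounded_linear_continuous _ _ _ (mulmxr A)).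
apply/linear_boundedP; near=> M => h /=.
have M0 : \sum_i \sum_j `|A i j| <= M.
  by near: M; apply: nbhs_pinfty_ge; exact: num_real.
have A0 : 0 <= \sum_i \sum_j `|A i j| by do 2 (apply: sumr_ge0 => ? _).
apply: le_trans (ler_wpM2r _ M0) => //.
apply: normr_rowP => [|j]; first by rewrite mulr_ge0.
rewrite mxE (le_trans (ler_norm_sum _ _ _))// mulr_suml ler_sum// => i _.
rewrite normrM mulrC ler_pM// ?ler_norm_coord//.
by rewrite (bigD1 j)//= lerDl sumr_ge0.
Unshelve. all: by end_near. Qed.

Lemma quadratic_remainder_diff (V W : normedModType R) (f : V -> W)
    (L : {linear V -> W}) z (k e : R) : continuous L -> 0 < e ->
  (forall h, `|h| <= e -> `|f (h + z) - f z - L h| <= k * `|h| ^+ 2) ->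
  differentiable f z /\ 'd f z = L :> (V -> W).
Proof.
move=> cL e0 fk.
have fo : f \o shift z = cst (f z) + L +o_ 0 id.
  apply/eqaddoP => eps eps0; near=> h.
  rewrite -[leLHS]/(`|f (h + z) - (f z + L h)|) opprD addrA.
  have k1 : 0 < `|k| + 1 by rewrite ltr_wpDl.
  have he : `|h| <= e by near: h; exact: nbhs0_le.
  have hk : `|h| <= eps / (`|k| + 1).
    by near: h; apply: nbhs0_le; rewrite divr_gt0.
  apply: (le_trans (fk _ he)); rewrite expr2 mulrA ler_wpM2r//.
  move: hk; rewrite ler_pdivlMr// mulrC; apply: le_trans.
  by rewrite ler_wpM2r// (le_trans (ler_norm _))// lerDl.
have dfL : 'd f z = L :> (V -> W) by exact: diff_unique.
by split => //; apply/diff_locallyP; rewrite dfL.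
Unshelve. all: by end_near. Qed.

Lemma quadratic_remainder_jacobian m n (f : 'rV[R]_m -> 'rV[R]_n) z
    (A : 'M[R]_(m, n)) (k e : R) : 0 < e ->
  (forall h, `|h| <= e -> `|f (h + z) - f z - h *m A| <= k * `|h| ^+ 2) ->
  differentiable f z /\ 'J f z = A.
Proof.
move=> e0 fk; have cA := @mulmx_continuous m n A.
have [df dfA] := @quadratic_remainder_diff _ _ f (mulmxr A) z k e cA e0 fk.
split=> //.
by apply/row_matrixP => i; rewrite /jacobian !rowE mul_rV_lin1 dfA.
Qed.

End jacobian_criterion.

(** From [1 + u <= expR u] and the same at [- u], whence
[expR u * (1 - u) <= 1]. *)
Lemma normr_expR_taylor1_le (R : realType) (u : R) : `|u| <= 2^-1 ->
  `|expR u - 1 - u| <= 2 * u ^+ 2.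
Proof.
move=> u2; have /andP[ul ur] : - 2^-1 <= u <= 2^-1 by rewrite -ler_norml.
have e1 := expR_ge1Dx u; have e2 := expR_ge1Dx (- u).
have e0 := expR_gt0 u.
have e3 : expR u * expR (- u) = 1 by rewrite -expRD subrr expR0.
have e4 : expR u * (1 - u) <= 1 by rewrite -[leRHS]e3 ler_pM2l.
rewrite ger0_norm; last by rewrite subr_ge0 lerBrDr addrC.
nra.
Qed.

Definition lin_form (R : realType) (p : nat) (h : 'rV[R]_p)
    (th : p.-tuple R) : R :=
  \sum_i h 0 i * tnth th i.

Lemma bounded_measurable_lin_form (R : realType) (p : nat) (h : 'rV[R]_p) :
  bounded_measurable (cube p) (lin_form h).
Proof.
apply: bounded_measurable_sum => i; apply: bounded_measurableZ.
exact: bounded_measurable_tnth.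
Qed.

Section tilted_mean.
Context (R : realType) (p : nat) (P : probability (p.-tuple R) R).
Hypothesis PK : P (cube p) = 1%E.
Local Notation E f := (\int[P]_x f x).

Let mK := @measurable_cube R p.
Let bt := @bounded_measurable_tnth R p.

Definition mean i := E (fun th : p.-tuple R => tnth th i).
Definition dev i (th : p.-tuple R) := tnth th i - mean i.
Definition covar i j := E (fun th => dev i th * dev j th).

Lemma bounded_measurable_dev i : bounded_measurable (cube p) (dev i).
Proof. by apply: bounded_measurableB => //; exact: bounded_measurable_cst. Qed.
Let bd := bounded_measurable_dev.

Lemma normr_mean_le1 i : `|mean i| <= 1.
Proof. by apply: (normr_bounded_Rintegral_le mK PK (bt i)) => th; exact. Qed.

Lemma normr_dev_le2 i th : cube p th -> `|dev i th| <= 2.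
Proof.
move=> /(_ i) thi; rewrite (le_trans (ler_normB _ _))//.
by rewrite (lerD thi (normr_mean_le1 i)).
Qed.

Lemma expectation_dev i : E (dev i) = 0.
Proof.
rewrite (bounded_RintegralB mK PK (bt i) (bounded_measurable_cst _ _)).
by rewrite probability_Rintegral_cst subrr.
Qed.

(** Write [u] for [lin_form h], bounded by [e := p |h|] on the cube, [g] for
[theta_j] minus the claimed expansion of its mean, and [expR u = 1 + u + r].
The difference to bound is the average of [g * expR u] over that of [expR u].
In the numerator the constant and linear terms cancel up to the product of two
first order quantities, and the rest is the average of [g * r]; both are
quadratic in [e], while the denominator is at least 1/2. *)
Lemma tilted_mean_expansion (h : 'rV[R]_p) (j : 'I_p) :
  p%:R * `|h| <= 2^-1 ->
  `|E (fun th => tnth th j * expR (lin_form h th)) /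
      E (fun th => expR (lin_form h th)) - mean j - \sum_i h 0 i * covar i j|
  <= 16 * (p%:R * `|h|) ^+ 2.
Proof.
set e := p%:R * `|h|; move=> e2; set u := lin_form h.
have e0 : 0 <= e by rewrite mulr_ge0.
have bu : bounded_measurable (cube p) u.
  exact: bounded_measurable_lin_form.
have ue th : cube p th -> `|u th| <= e.
  move=> thK; rewrite (le_trans (ler_norm_sum _ _ _))//.
  rewrite (@le_trans _ _ (\sum_(i < p) `|h|))//.
    apply: ler_sum => i _; rewrite normrM.
    by rewrite (le_trans (ler_piMr _ (thK i)))// ler_norm_coord.
  by rewrite sumr_const card_ord -mulr_natl.
pose c := E (fun th => u th * dev j th).
(* Centring one of the two factors of a covariance is enough. *)
have cE : \sum_i h 0 i * covar i j = c.
  pose M := \sum_i h 0 i * mean i.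
  have -> : c = E (fun th => u th * dev j th - M * dev j th).
    rewrite (bounded_RintegralB mK PK); last 2 first.
      exact: bounded_measurableM.
      exact: bounded_measurableZ.
    by rewrite (bounded_RintegralZl mK PK)// expectation_dev mulr0 subr0.
  transitivity (\sum_i E (fun th => h 0 i * (dev i th * dev j th))).
    apply: eq_bigr => i _; rewrite (bounded_RintegralZl mK PK)//.
    exact: bounded_measurableM.
  rewrite -(bounded_Rintegral_sum mK PK); last first.
    by move=> i; apply: bounded_measurableZ; exact: bounded_measurableM.
  apply: eq_Rintegral => th _; rewrite /u /lin_form /M -mulrBl -sumrB mulr_suml.
  by apply: eq_bigr => i _; rewrite /dev; ring.
rewrite cE.
pose r th := expR (u th) - 1 - u th.
have br : bounded_measurable (cube p) r.
  apply: bounded_measurableB => //; apply: bounded_measurableB.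
    exact: bounded_measurable_expR.
  exact: bounded_measurable_cst.
have re th : cube p th -> `|r th| <= 2 * e ^+ 2.
  move=> thK; rewrite (le_trans (normr_expR_taylor1_le _)) ?(le_trans (ue _ thK))//.
  by rewrite ler_pM2l// -real_normK ?num_real// ler_pXn2r ?nnegrE// ue.
have ce : `|c| <= 2 * e.
  apply: (normr_bounded_Rintegral_le mK PK) => [|th thK].
    exact: bounded_measurableM.
  by rewrite normrM mulrC ler_pM ?ue ?normr_dev_le2.
have ue' : `|E u| <= e by exact: (normr_bounded_Rintegral_le mK PK).
pose g th := dev j th - c.
have bg : bounded_measurable (cube p) g.
  by apply: bounded_measurableB => //; exact: bounded_measurable_cst.
have gre : `|E (fun th => g th * r th)| <= 6 * e ^+ 2.
  apply: (normr_bounded_Rintegral_le mK PK) => [|th thK].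
    exact: bounded_measurableM.
  rewrite normrM (_ : 6 * e ^+ 2 = 3 * (2 * e ^+ 2)); last by ring.
  apply: ler_pM => //; last exact: re.
  rewrite (le_trans (ler_normB _ _))// (le_trans (lerD (normr_dev_le2 j thK) ce))//.
  lra.
have beu : bounded_measurable (cube p) (fun th => expR (u th)).
  exact: bounded_measurable_expR.
set B := E (fun th => expR (u th)).
have B2 : 2^-1 <= B.
  apply: (bounded_Rintegral_ge mK PK) => // th thK.
  rewrite (le_trans _ (expR_ge1Dx _))//.
  have := ue th thK; rewrite ler_norml => /andP[]; lra.
set N := E (fun th => tnth th j * expR (u th)).
have NE : N - (mean j + c) * B = - c * E u + E (fun th => g th * r th).
  have -> : N - (mean j + c) * B = E (fun th => g th * expR (u th)).
    rewrite -(bounded_RintegralZl mK PK)// -(bounded_RintegralB mK PK).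
    - by apply: eq_Rintegral => th _; rewrite /g /dev; ring.
    - exact: bounded_measurableM.
    - exact: bounded_measurableZ.
  have Eg : E g = - c.
    rewrite (bounded_RintegralB mK PK (bd j) (bounded_measurable_cst _ _)).
    by rewrite expectation_dev probability_Rintegral_cst sub0r.
  have Egu : E (fun th => g th * u th) = c - c * E u.
    rewrite -(bounded_RintegralZl mK PK)// -(bounded_RintegralB mK PK).
    - by apply: eq_Rintegral => th _; rewrite /g; ring.
    - exact: bounded_measurableM.
    - exact: bounded_measurableZ.
  have bgu : bounded_measurable (cube p) (fun th => g th * u th).
    exact: bounded_measurableM.
  have bgr : bounded_measurable (cube p) (fun th => g th * r th).
    exact: bounded_measurableM.
  transitivity (E (fun th => g th + g th * u th + g th * r th)).
    by apply: eq_Rintegral => th _; rewrite /r; ring.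
  rewrite (bounded_RintegralD mK PK)//; last exact: bounded_measurableD.
  by rewrite (bounded_RintegralD mK PK)// Eg Egu; ring.
have B0 : B != 0 by rewrite gt_eqF//; lra.
have -> : N / B - mean j - c = (N - (mean j + c) * B) / B by field.
rewrite NE normrM normfV (@ger0_norm _ B); last by lra.
rewrite ler_pdivrMr; last by lra.
apply: (@le_trans _ _ (8 * e ^+ 2)); last first.
  by have := sqr_ge0 e; nra.
rewrite (le_trans (ler_normD _ _))//.
rewrite (_ : 8 * _ = 2 * e * e + 6 * e ^+ 2); last by ring.
by rewrite lerD// normrM normrN ler_pM.
Qed.

End tilted_mean.

(** * The variance of the overlap *)

Section product_integral.
Context d1 d2 (T1 : measurableType d1) (T2 : measurableType d2) (R : realType).
Variables (P1 : probability T1 R) (P2 : probability T2 R).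
Variables (K1 : set T1) (K2 : set T2).
Hypotheses (mK1 : measurable K1) (PK1 : P1 K1 = 1%E).
Hypotheses (mK2 : measurable K2) (PK2 : P2 K2 = 1%E).

Let PP : probability (T1 * T2)%type R := (P1 \x P2)%E.

Lemma product_full : PP (K1 `*` K2) = 1%E.
Proof.
apply: (etrans (product_measure1E P1 P2 mK1 mK2)).
by rewrite [X in (X * _)%E]PK1 [X in (_ * X)%E]PK2 mule1.
Qed.

Lemma bounded_measurable_prod f g :
  bounded_measurable K1 f -> bounded_measurable K2 g ->
  bounded_measurable (K1 `*` K2) (fun x : T1 * T2 => f x.1 * g x.2 : R).
Proof.
move=> [mf [M fM]] [mg [N gN]]; apply: bounded_measurableM.
  by split; [exact: measurableT_comp | exists M => x [/= /fM]].
by split; [exact: measurableT_comp | exists N => x [/= _ /gN]].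
Qed.

Lemma Rintegral_prod f g :
  bounded_measurable K1 f -> bounded_measurable K2 g ->
  \int[PP]_x (f x.1 * g x.2) = (\int[P1]_x f x) * \int[P2]_x g x.
Proof.
move=> bf bg.
have bfg := bounded_measurable_prod bf bg.
have mKK : measurable (K1 `*` K2) by exact: measurableX.
have itg := bounded_measurable_integrable mK2 PK2 measurableT bg.
have itf := bounded_measurable_integrable mK1 PK1 measurableT bf.
have itfg := bounded_measurable_integrable mKK product_full measurableT bfg.
rewrite {1}/Rintegral -(integral12_prod_meas1 itfg) /=.
rewrite -RintegralZr//; congr fine; apply: eq_integral => x _.
rewrite /fubini_F /=; under eq_integral do rewrite EFinM.
rewrite integralZl// EFinM; congr (_ * _)%E.
by rewrite /Rintegral fineK//; exact: integrable_fin_num.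
Qed.

End product_integral.

Section overlap_variance.
Context (R : realType) (p : nat) (P : probability (p.-tuple R) R).
Hypothesis PK : P (cube p) = 1%E.
Local Notation E f := (\int[P]_x f x).
Local Notation m := (mean P).
Local Notation C := (covar P).

Let mK := @measurable_cube R p.
Let bt := @bounded_measurable_tnth R p.
Let bd := bounded_measurable_dev P.

Lemma overlapE (x : p.-tuple R * p.-tuple R) :
  overlap x = p%:R^-1 * \sum_i tnth x.1 i * tnth x.2 i.
Proof.
by rewrite /overlap mxE; congr (_ * _); apply: eq_bigr => i _; rewrite !mxE.
Qed.

Lemma expectation_tnthM i j :
  E (fun th => tnth th i * tnth th j) = C i j + m i * m j.
Proof.
rewrite /covar.
have -> : (fun th => dev P i th * dev P j th) =
    (fun th => tnth th i * tnth th j - (m i * tnth th j + m j * tnth th i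
       - m i * m j)).
  by apply/funext => th; rewrite /dev; ring.
have b1 : bounded_measurable (cube p)
  (fun th => m i * tnth th j + m j * tnth th i).
  by apply: bounded_measurableD; exact: bounded_measurableZ.
have bc := bounded_measurable_cst (@cube R p) (m i * m j).
rewrite (bounded_RintegralB mK PK); last 2 first.
  exact: bounded_measurableM.
  exact: (bounded_measurableB b1 bc).
rewrite (bounded_RintegralB mK PK b1 bc) probability_Rintegral_cst.
rewrite (bounded_RintegralD mK PK); try exact: bounded_measurableZ.
rewrite !(bounded_RintegralZl mK PK)// -!/(mean _ _).
ring.
Qed.

Let PP : probability (p.-tuple R * p.-tuple R)%type R := (P \x P)%E.
Let KK := cube p `*` cube p : set (p.-tuple R * p.-tuple R).
Let mKK : measurable KK. Proof. exact: measurableX. Qed.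
Let PKK : PP KK = 1%E. Proof. exact: product_full. Qed.

Let bprod f g : bounded_measurable (cube p) f ->
  bounded_measurable (cube p) g ->
  bounded_measurable KK (fun x => f x.1 * g x.2 : R).
Proof. exact: bounded_measurable_prod. Qed.

Let bounded_measurable_overlap : bounded_measurable KK (@overlap R p).
Proof.
rewrite (_ : @overlap R p = fun x => p%:R^-1 * \sum_i tnth x.1 i * tnth x.2 i).
  apply: bounded_measurableZ; apply: bounded_measurable_sum => i.
  exact: (bprod (bt i) (bt i)).
by apply/funext => x; exact: overlapE.
Qed.

Lemma mean_overlap : \int[PP]_x overlap x = p%:R^-1 * \sum_i m i ^+ 2.
Proof.
under eq_Rintegral do rewrite overlapE.
have bi i := bprod (bt i) (bt i).
rewrite (bounded_RintegralZl mKK PKK); last exact: bounded_measurable_sum.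
rewrite (bounded_Rintegral_sum mKK PKK)//; congr (_ * _).
apply: eq_bigr => i _.
by rewrite (Rintegral_prod mK PK mK PK (bt i) (bt i)) expr2.
Qed.

(** By independence, the product of the [i]-th and [j]-th summands of the overlap
averages to the square of the second moment of [theta_i theta_j]. *)
Lemma mean_sqr_overlap : \int[PP]_x overlap x ^+ 2 =
  p%:R^-1 ^+ 2 * \sum_i \sum_j (C i j + m i * m j) ^+ 2.
Proof.
pose F i j (th : p.-tuple R) := tnth th i * tnth th j.
have bF i j : bounded_measurable (cube p) (F i j) by exact: bounded_measurableM.
have bFF i j := bprod (bF i j) (bF i j).
transitivity (\int[PP]_x (p%:R^-1 ^+ 2 * \sum_i \sum_j F i j x.1 * F i j x.2)).
  apply: eq_Rintegral => x _; rewrite overlapE exprMn; congr (_ * _).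
  rewrite expr2 big_distrl; apply: eq_bigr => i _ /=.
  by rewrite big_distrr; apply: eq_bigr => j _ /=; rewrite /F; ring.
rewrite (bounded_RintegralZl mKK PKK); last first.
  by do 2 apply: bounded_measurable_sum => ?.
congr (_ * _); rewrite (bounded_Rintegral_sum mKK PKK); last first.
  by move=> i; exact: bounded_measurable_sum.
apply: eq_bigr => i _; rewrite (bounded_Rintegral_sum mKK PKK)//.
apply: eq_bigr => j _; rewrite (Rintegral_prod mK PK mK PK (bF i j) (bF i j)).
by rewrite /F expectation_tnthM expr2.
Qed.

(** Squaring the second moments [C i j + m i * m j] leaves, once the squared mean
is subtracted, the Frobenius norm of the covariance and a cross term, the
quadratic form of [C] at the mean. *)
Lemma overlap_variance (q := \int[PP]_x overlap x) :
  \int[PP]_x `|overlap x - q| ^+ 2 =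
  p%:R^-1 ^+ 2 * (\sum_i \sum_j C i j ^+ 2 +
                  2 * \sum_i \sum_j m i * C i j * m j).
Proof.
have bo := bounded_measurable_overlap.
have bc := bounded_measurable_cst KK (q ^+ 2).
have bqo := bounded_measurableZ (2 * q) bo.
transitivity (\int[PP]_x (overlap x ^+ 2 - (2 * q * overlap x - q ^+ 2))).
  by apply: eq_Rintegral => x _; rewrite real_normK ?num_real//; ring.
rewrite (bounded_RintegralB mKK PKK); last 2 first.
  exact: bounded_measurableX.
  exact: (bounded_measurableB bqo bc).
rewrite (bounded_RintegralB mKK PKK bqo bc) probability_Rintegral_cst.
rewrite (bounded_RintegralZl mKK PKK)// mean_sqr_overlap -/q.
have -> : q = p%:R^-1 * \sum_i m i ^+ 2 by exact: mean_overlap.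
have -> : \sum_i \sum_j (C i j + m i * m j) ^+ 2 =
    \sum_i \sum_j C i j ^+ 2 + 2 * (\sum_i \sum_j m i * C i j * m j)
    + (\sum_i m i ^+ 2) ^+ 2.
  have -> : (\sum_i m i ^+ 2) ^+ 2 = \sum_i \sum_j m i ^+ 2 * m j ^+ 2.
    by rewrite expr2 mulr_suml; apply: eq_bigr => i _; rewrite mulr_sumr.
  rewrite mulr_sumr -!big_split /=.
  apply: eq_bigr => i _; rewrite mulr_sumr -!big_split /=.
  by apply: eq_bigr => j _; ring.
by ring.
Qed.

(** Each coordinate has second moment [C i i + m i ^+ 2] at most 1, hence also
[m i ^+ 2 <= 1] as [C i i] is nonnegative. *)
Lemma sum_variance_le : \sum_i C i i + 2 * \sum_i m i ^+ 2 <= 2 * p%:R.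
Proof.
have Cm i : C i i + m i ^+ 2 <= 1.
  rewrite expr2 -expectation_tnthM (le_trans (ler_norm _))//.
  apply: (normr_bounded_Rintegral_le mK PK) => [|th thK].
    exact: bounded_measurableM.
  by rewrite normrM mulr_ile1.
have C0 i : 0 <= C i i.
  apply: (bounded_Rintegral_ge mK PK) => [|th thK].
    exact: bounded_measurableM.
  by rewrite -expr2 sqr_ge0.
rewrite mulr_sumr -big_split /=.
rewrite (_ : 2 * p%:R = \sum_(i < p) 2); last first.
  by rewrite sumr_const card_ord mulr_natr.
apply: ler_sum => i _; have := Cm i; have := C0 i; lra.
Qed.

Lemma expectation_quad_form (A : 'I_p -> 'I_p -> R) :
  E (fun th => \sum_i \sum_j A i j * (dev P i th * dev P j th)) =
  \sum_i \sum_j A i j * C i j.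
Proof.
have bdd i j : bounded_measurable (cube p)
    (fun th => A i j * (dev P i th * dev P j th)).
  by apply: bounded_measurableZ; exact: bounded_measurableM.
rewrite (bounded_Rintegral_sum mK PK); last first.
  by move=> i; exact: bounded_measurable_sum.
apply: eq_bigr => i _; rewrite (bounded_Rintegral_sum mK PK)//.
apply: eq_bigr => j _; rewrite (bounded_RintegralZl mK PK)//.
exact: bounded_measurableM.
Qed.

Let bquad (A : 'I_p -> 'I_p -> R) : bounded_measurable (cube p)
  (fun th => \sum_i \sum_j A i j * (dev P i th * dev P j th)).
Proof.
do 2 apply: bounded_measurable_sum => ?.
by apply: bounded_measurableZ; exact: bounded_measurableM.
Qed.

(** The form at [v] is the variance of the linear functional [v]. *)
Lemma covar_psd (v : 'I_p -> R) : 0 <= \sum_i \sum_j v i * C i j * v j.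
Proof.
under eq_bigr do under eq_bigr do rewrite mulrAC.
rewrite -(expectation_quad_form (fun i j => v i * v j)).
apply: (bounded_Rintegral_ge mK PK (bquad _)) => th thK.
have -> : \sum_i \sum_j v i * v j * (dev P i th * dev P j th) =
    (\sum_i v i * dev P i th) ^+ 2.
  rewrite expr2 big_distrl; apply: eq_bigr => i _ /=.
  by rewrite big_distrr; apply: eq_bigr => j _ /=; ring.
exact: sqr_ge0.
Qed.

(** In spectral terms, each eigenvalue satisfies [l ^+ 2 <= lam * l]. Here the
diagonalization is replaced by an average: applying the hypothesis to the
random vector [v = theta - m] and integrating turns [|v|^2] into the trace of
[C], and the form of [C] at [v] into its squared Frobenius norm. *)
Lemma covar_frobenius_le (lam : R) :
  (forall v : 'I_p -> R,
    \sum_i \sum_j v i * C i j * v j <= lam * \sum_i v i ^+ 2) ->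
  \sum_i \sum_j C i j ^+ 2 <= lam * \sum_i C i i.
Proof.
move=> ray; rewrite -subr_ge0.
pose A i j := (if i == j then lam else 0) - C i j.
have rowE i (F : 'I_p -> R) :
    \sum_j (if i == j then lam else 0) * F j = lam * F i.
  rewrite (bigD1 i)//= eqxx big1 ?addr0// => j ji.
  by rewrite eq_sym (negPf ji) mul0r.
have -> : lam * (\sum_i C i i) - \sum_i \sum_j C i j ^+ 2 =
    \sum_i \sum_j A i j * C i j.
  rewrite mulr_sumr -sumrB; apply: eq_bigr => i _.
  by rewrite -rowE -sumrB; apply: eq_bigr => j _; rewrite /A mulrBl expr2.
rewrite -expectation_quad_form.
apply: (bounded_Rintegral_ge mK PK (bquad _)) => th thK.
have expand (a b c d : R) : a * (b * c) - b * d * c = (a - d) * (b * c).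
  by ring.
have := ray (dev P ^~ th); rewrite -subr_ge0; congr (0 <= _).
rewrite mulr_sumr -sumrB; apply: eq_bigr => i _.
rewrite expr2 -(rowE i (fun j => dev P i th * dev P j th)) -sumrB.
apply: eq_bigr => j _; rewrite /A /=; exact: expand.
Qed.

End overlap_variance.

(** * The Gibbs measure *)

Section gibbs_facts.
Context (R : realType) (n p : nat) (phi : 'M[R]_(n, p)) (y : 'cV[R]_n)
  (alpha Delta t : R) (P0 : probability R R).
Hypotheses (t0 : t != 0) (P0_supp : P0 `[-1, 1]%classic = 1%E).
Local Notation G := (gibbs phi y alpha Delta t P0).

Let priorK := prior_cube p P0_supp.
Let blw := bounded_measurable_log_weight phi y alpha Delta t.

Lemma gibbs_cube z : G z (cube p) = 1%E.
Proof.
exact: (mnormalize_tilted_full (@measurable_cube R p) priorK (blw z)).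
Qed.

Lemma gibbs_shift z h (f : p.-tuple R -> R) : bounded_measurable (cube p) f ->
  \int[G (h + z)]_th f th =
  (\int[G z]_th (f th * expR (lin_form h th))) /
  \int[G z]_th expR (lin_form h th).
Proof.
move=> bf; apply: (Rintegral_retilt (@measurable_cube R p) priorK (blw z)
  (bounded_measurable_lin_form h) bf) => th.
exact: log_weight_shift.
Qed.

Lemma gibbs_meanE z i : gibbs_mean phi y alpha Delta t P0 z i 0 = mean (G z) i.
Proof. by rewrite mxE; apply: eq_Rintegral => th _; rewrite mxE. Qed.

Lemma gibbs_covE z i j :
  gibbs_cov phi y alpha Delta t P0 z i j = covar (G z) i j.
Proof.
rewrite !mxE.
have -> : \int[G z]_th (vec th *m (vec th)^T) i j =
    \int[G z]_th (tnth th i * tnth th j).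
  by apply: eq_Rintegral => th _; rewrite !mxE big_ord1 !mxE.
rewrite (expectation_tnthM (gibbs_cube z)) big_ord1 !mxE.
by rewrite -!gibbs_meanE !mxE addrK.
Qed.

Lemma gibbs_cov_sym z :
  (gibbs_cov phi y alpha Delta t P0 z)^T = gibbs_cov phi y alpha Delta t P0 z.
Proof.
apply/matrixP => i j; rewrite mxE !gibbs_covE; apply: eq_Rintegral => th _.
exact: mulrC.
Qed.

Lemma jacobian_m z : (0 < p)%N ->
  differentiable (m_ phi y alpha Delta t P0) z /\
  'J (m_ phi y alpha Delta t P0) z = gibbs_cov phi y alpha Delta t P0 z.
Proof.
move=> p0; have p0' : 0 < p%:R :> R by rewrite ltr0n.
apply: (@quadratic_remainder_jacobian _ _ _ _ _ _ (16 * p%:R ^+ 2) (2 * p%:R)^-1).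
  by rewrite invr_gt0 mulr_gt0.
move=> h hp; have hp' : p%:R * `|h| <= 2^-1.
  by move: hp; rewrite invfM ler_pdivlMr// mulrC.
apply: normr_rowP => [|j]; first by rewrite !mulr_ge0 ?sqr_ge0.
rewrite -mulrA -exprMn.
have mE z' : m_ phi y alpha Delta t P0 z' 0 j = mean (G z') j.
  by rewrite mxE gibbs_meanE.
have coordE (f : 'rV[R]_p -> 'rV[R]_p) (A : 'M[R]_p) (mu : 'rV[R]_p -> R)
    (c : 'I_p -> R) : (forall z', f z' 0 j = mu z') ->
    (forall i, A i j = c i) ->
    (f (h + z) - f z - h *m A) 0 j =
    mu (h + z) - mu z - \sum_i h 0 i * c i.
  move=> fmu Ac; rewrite !mxE !fmu; congr (_ - _).
  by apply: eq_bigr => i _; rewrite Ac.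
rewrite (coordE _ _ _ _ mE (fun i => gibbs_covE z i j)).
have := tilted_mean_expansion (gibbs_cube z) j hp'.
by rewrite -(gibbs_shift z h (bounded_measurable_tnth R j)).
Qed.

End gibbs_facts.

(** * Overlap fluctuations and the largest eigenvalue *)

Theorem proposition2 (R : realType) (n p : nat) (phi : 'M[R]_(n, p))
    (y : 'cV[R]_n) (alpha Delta t : R) (P0 : probability R R) (z : 'rV[R]_p)
    (p_gt0 : (0 < p)%N) (alpha_gt0 : 0 < alpha) (Delta_gt0 : 0 < Delta)
    (t_gt0 : 0 < t) (P0_supp : P0 `[-1, 1]%classic = 1%E) :
  let m_t := m_ phi y alpha Delta t P0 in
  let cov := gibbs_cov phi y alpha Delta t P0 z in
  let avg2 := gibbs2 phi y alpha Delta t P0 z in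
  let q_p := avg2 (@overlap R p) in
  let var_overlap := avg2 (fun x => `|overlap x - q_p| ^+ 2) in
  let lambda_m := lambda_max ('J m_t z) in
  [/\ differentiable m_t z,
      'J m_t z = cov,
      lambda_m = lambda_max cov,
      p%:R / 2 * var_overlap <= lambda_m &
      lambda_m <= p%:R * Num.sqrt var_overlap].
Proof.
move=> m_t cov avg2 q_p var_overlap lambda_m.
have t0 : t != 0 by rewrite gt_eqF.
have [dm Jm] : differentiable m_t z /\ 'J m_t z = cov.
  exact: (jacobian_m phi y alpha Delta t0 P0_supp).
have lamE : lambda_m = lambda_max cov by rewrite /lambda_m Jm.
pose G := gibbs phi y alpha Delta t P0 z.
have GK : G (cube p) = 1%E by exact: gibbs_cube.
have [elam ray] := lambda_maxP p_gt0 (gibbs_cov_sym phi y alpha Delta t P0_supp z).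
rewrite -/cov -lamE in elam ray.
have covE i j : cov i j = covar G i j by exact: gibbs_covE.
set C := covar G in covE; set m := mean G.
pose F := \sum_i \sum_j C i j ^+ 2.
pose Q := \sum_i \sum_j m i * C i j * m j.
have quadE (v : 'I_p -> R) :
    \sum_i \sum_j v i * C i j * v j <= lambda_m * \sum_i v i ^+ 2.
  have := ray (\row_i v i); rewrite quad_formE dotvE.
  congr (_ <= _ * _).
    by do 2 (apply: eq_bigr => ? _); rewrite covE !mxE.
  by apply: eq_bigr => i _; rewrite !mxE expr2.
have Q0 : 0 <= Q by exact: covar_psd.
have Fle : F <= lambda_m * \sum_i C i i by exact: covar_frobenius_le.
have lam2 : lambda_m ^+ 2 <= F.
  have := sqr_eigenvalue_le elam; congr (_ <= _).
  by do 2 (apply: eq_bigr => ? _); rewrite covE.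
have p0 : 0 < p%:R :> R by rewrite ltr0n.
have varE : var_overlap = p%:R^-1 ^+ 2 * (F + 2 * Q).
  exact: (overlap_variance GK).
have var2 : p%:R ^+ 2 * var_overlap = F + 2 * Q.
  by rewrite varE mulrA -exprMn divff ?gt_eqF// expr1n mul1r.
have trm := sum_variance_le GK.
(* Compare with the variance of a single coordinate. *)
have lam0 : 0 <= lambda_m.
  have := quadE (fun i => (i == Ordinal p_gt0)%:R).
  have := covar_psd GK (fun i => (i == Ordinal p_gt0)%:R).
  move=> /le_trans /[apply]; rewrite pmulr_lge0//.
  rewrite (bigD1 (Ordinal p_gt0))//= ?eqxx expr1n.
  by rewrite ltr_wpDr// sumr_ge0// => i _; exact: sqr_ge0.
split => //.
- rewrite -(ler_pM2l p0) mulrA [p%:R * (_ / _)]mulrA -expr2 mulrAC var2.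
  rewrite ler_pdivrMr//.
  have := quadE m; rewrite -/Q => Qle.
  have := ler_wpM2l lam0 trm; rewrite -/C -/m mulrDr.
  lra.
- have -> : p%:R * Num.sqrt var_overlap = Num.sqrt (F + 2 * Q).
    by rewrite -var2 sqrtrM ?sqr_ge0// sqrtr_sqr gtr0_norm.
  rewrite -(ger0_norm lam0) -sqrtr_sqr; apply: ler_wsqrtr.
  by rewrite (le_trans lam2)// lerDl mulr_ge0.
Qed.
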